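(* Let $m\ge 3$ be an integer or $m=\infty$. Suppose $g(\boldsymbol{x})$ with $\boldsymbol{x}\in\mathbb{C}^n$ is a real-valued general conjugate form (of degree $d$) associated with a conjugate super-symmetric tensor $\mathcal{G}\in\mathbb{C}^{(2n)^d}$, and let $G$ be the complex multilinear form associated with $\mathcal{G}$. If $\xi_1,\xi_2,\dots,\xi_d$ are i.i.d. random variables uniformly distributed on $\mathbf{\Omega}_m$, then for any $\boldsymbol{x}^1,\dots,\boldsymbol{x}^d,\boldsymbol{y}^1,\dots,\boldsymbol{y}^d\in\mathbb{C}^n$, $$\mathrm{E}\left[\left(\prod_{i=1}^d\overline{\xi_i}\right) g\left(\sum_{k=1}^d\left(\overline{\xi_k\boldsymbol{x}^k}+\xi_k\boldsymbol{y}^k\right)\right)\right]=d!\;G\left(\binom{\boldsymbol{x}^1}{\boldsymbol{y}^1},\binom{\boldsymbol{x}^2}{\boldsymbol{y}^2},\dots,\binom{\boldsymbol{x}^d}{\boldsymbol{y}^d}\right).$$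
   Context: For an integer $m$, $\mathbf{\Omega}_m=\{1,\omega_m,\dots,\omega_m^{m-1}\}$ with $\omega_m=e^{\mathbf{i}2\pi/m}$ is the set of $m$-th roots of unity; $\mathbf{\Omega}_\infty=\{z\in\mathbb{C}:|z|=1\}$ is the complex unit circle. A bar denotes (entrywise) complex conjugation. A general conjugate form of degree $d$ in $\boldsymbol{x}\in\mathbb{C}^n$ is a function $$g(\boldsymbol{x})=\sum_{k=0}^d\ \sum_{1\le i_1\le\dots\le i_k\le n}\ \sum_{1\le j_1\le\dots\le j_{d-k}\le n}a_{i_1\dots i_k,j_1\dots j_{d-k}}\,\overline{x_{i_1}\cdots x_{i_k}}\,x_{j_1}\cdots x_{j_{d-k}}$$ with complex coefficients; it is real-valued if $g(\boldsymbol{x})\in\mathbb{R}$ for all $\boldsymbol{x}\in\mathbb{C}^n$. A tensor $\mathcal{G}\in\mathbb{C}^{(2n)^d}$ (order $d$, each index ranging over $1,\dots,2n$) is conjugate super-symmetric if (i) $\mathcal{G}$ is symmetric, i.e., its entries are invariant under permutations of the indices, and (ii) $\mathcal{G}_{i_1\dots i_d}=\overline{\mathcal{G}_{j_1\dots j_d}}$ for all $1\le i_1,\dots,i_d,j_1,\dots,j_d\le 2n$ with $|i_k-j_k|=n$ for $k=1,\dots,d$. The multilinear form associated with $\mathcal{G}$ is $G(\boldsymbol{z}^1,\dots,\boldsymbol{z}^d)=\sum_{i_1,\dots,i_d=1}^{2n}\mathcal{G}_{i_1\dots i_d}z^1_{i_1}\cdots z^d_{i_d}$ for $\boldsymbol{z}^k\in\mathbb{C}^{2n}$.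 The real-valued general conjugate form $g$ is associated with $\mathcal{G}$ when $$g(\boldsymbol{x})=G\Big(\underbrace{\tbinom{\overline{\boldsymbol{x}}}{\boldsymbol{x}},\dots,\tbinom{\overline{\boldsymbol{x}}}{\boldsymbol{x}}}_{d}\Big)\quad\text{for all }\boldsymbol{x}\in\mathbb{C}^n,$$ where $\binom{\boldsymbol{x}}{\boldsymbol{y}}\in\mathbb{C}^{2n}$ is the vector obtained by stacking $\boldsymbol{x}$ on top of $\boldsymbol{y}$. *)

(* Defs.v *)
From HB Require Import structures.
From mathcomp Require Import all_boot all_order all_algebra all_fingroup.
From mathcomp Require Import complex.
From mathcomp Require Import all_classical all_reals all_analysis.

Set Implicit Arguments.
Unset Strict Implicit.
Unset Printing Implicit Defensive.

Import Order.TTheory GRing.Theory Num.Theory IntDist.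
Import numFieldNormedType.Exports.

Local Open Scope classical_set_scope.
Local Open Scope complex_scope.
Local Open Scope ring_scope.

Section ConjugateForms.
Variable C : numClosedFieldType.

Definition nondecreasing_index (k n : nat) (i : {ffun 'I_k -> 'I_n}) : bool :=
  [forall s : 'I_k, forall t : 'I_k, (s <= t)%N ==> (i s <= i t)%N].

Definition general_conjugate_form (n d : nat) (g : 'cV[C]_n -> C) : Prop :=
  exists a : forall k : nat,
      {ffun 'I_k -> 'I_n} -> {ffun 'I_(d - k) -> 'I_n} -> C,
    forall x : 'cV[C]_n,
      g x = \sum_(k < d.+1)
              \sum_(i : {ffun 'I_k -> 'I_n} | nondecreasing_index i)
                \sum_(j : {ffun 'I_(d - k) -> 'I_n} | nondecreasing_index j)
                  a k i j * (\prod_s x (i s) 0)^* * \prod_t x (j t) 0.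

Definition real_valued (n : nat) (g : 'cV[C]_n -> C) : Prop :=
  forall x : 'cV[C]_n, g x \is Num.real.

Definition tensor (N d : nat) : Type := {ffun 'I_d -> 'I_N} -> C.

(* `|i k - j k|%N is the distance between naturals, not a truncated
   difference. *)
Definition conjugate_super_symmetric (n d : nat) (G : tensor (n + n) d) : Prop :=
  (forall (s : 'S_d) (i : {ffun 'I_d -> 'I_(n + n)}),
      G [ffun k => i (s k)] = G i) /\
  (forall i j : {ffun 'I_d -> 'I_(n + n)},
      (forall k, `|i k - j k|%N = n) -> G i = (G j)^*).

Definition multilinear_form (N d : nat) (G : tensor N d)
    (z : 'I_d -> 'cV[C]_N) : C :=
  \sum_(i : {ffun 'I_d -> 'I_N}) G i * \prod_(k < d) z k (i k) 0.

Definition conj_vec (n : nat) (x : 'cV[C]_n) : 'cV[C]_n :=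
  map_mx (fun c : C => c^*) x.

Definition associated (n d : nat) (g : 'cV[C]_n -> C)
    (G : tensor (n + n) d) : Prop :=
  forall x : 'cV[C]_n,
    g x = multilinear_form G (fun=> col_mx (conj_vec x) x).

End ConjugateForms.

(* The Borel sigma-algebra of the complex plane; the topology of R[i] is
   carried by the alias R[i]^o. *)
Definition borelC (R : realType) := g_sigma_algebraType (@open R[i]^o).

Section Probability.
Context d (T : measurableType d) (R : realType) (P : probability T R).

Definition mutually_independent d' (T' : measurableType d') (I : finType)
    (X : I -> {RV P >-> T'}) : Prop :=
  forall (J : {set I}) (A : I -> set T'),
    (forall i, i \in J -> measurable (A i)) ->
    P (\bigcap_(i in [set` J]) (X i @^-1` A i)) =
      (\prod_(i in J) P (X i @^-1` A i))%E.

Definition integrableC (X : T -> R[i]) : Prop :=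
  P.-integrable setT (fun w => (complex.Re (X w))%:E) /\
  P.-integrable setT (fun w => (complex.Im (X w))%:E).

(* Only meaningful under integrableC: fine sends infinities to 0. *)
Definition expectationC (X : T -> R[i]) : R[i] :=
  fine 'E_P[fun w => complex.Re (X w)] +i*
  fine 'E_P[fun w => complex.Im (X w)].

Definition expi (t : R) : R[i] := cos t +i* sin t.

Definition omega (m : nat) : R[i] := expi (pi *+ 2 / m%:R).

Definition roots_of_unity (m : nat) : set R[i] :=
  [set omega m ^+ k | k in `I_m].

Lemma two_pi_gt0 : 0 < pi *+ 2 :> R.
Proof. by rewrite mulrn_wgt0 // pi_gt0. Qed.

(* None stands for m = oo: the uniform distribution on the unit circle is the
   law of expi t for t uniform on [0, 2 pi]. *)
Definition uniform_on_Omega (m : option nat) (X : {RV P >-> borelC R}) : Prop :=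
  match m with
  | Some m => forall z : R[i], roots_of_unity m z ->
      distribution P X [set z] = (m%:R^-1)%:E
  | None => forall A : set (borelC R), measurable A ->
      distribution P X A = uniform_prob two_pi_gt0 (expi @^-1` A)
  end.

End Probability.

(* Main.v *)
Require Import Defs.
From HB Require Import structures.
From mathcomp Require Import all_boot all_order all_algebra all_fingroup.
From mathcomp Require Import complex finmap.
From mathcomp Require Import all_classical all_reals all_analysis.
From mathcomp Require Import measurable_realfun ring lra.
Import Order.TTheory GRing.Theory Num.Theory.
Import numFieldNormedType.Exports.
Local Open Scope classical_set_scope.
Local Open Scope ring_scope.

(** Write [z_k] for the vector that stacks [x^k] on [y^k], and [z'_k] for the
    one that stacks the conjugate of [y^k] on the conjugate of [x^k].  The
    vector [v] at which [g] is evaluated is such that the stack of its conjugate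
    on itself is the sum over [k] of [xi_k z_k + conj xi_k z'_k].  Expanding the
    multilinear form along this sum ([col_mx_conj_sum],
    [multilinear_form_sum]) writes the random variable as a finite combination
    of products over [k] of monomials in [xi_k] and [conj xi_k], indexed by the
    functions [phi] that send each of the [d] slots of the form to some [z_k] or
    [z'_k].

    By independence, the expectation of such a product is the product of the
    expectations of its factors ([independent_expectationC_prod]).  The factor
    at [k] contains [conj xi_k] from the prefactor.  Only three of its possible
    values matter.  If no slot receives an index-[k] vector, the factor is
    [conj xi_k], of mean [0].  If exactly one slot does and it holds [z'_k], the
    factor is [conj xi_k ^ 2], again of mean [0]: this is where [3 <= m] is
    needed, since [xi ^ 2 = 1] for [m = 2].  If exactly one slot does and it
    holds [z_k], the factor is [|xi_k| ^ 2 = 1] almost surely.  By the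
    pigeonhole principle a [phi] that avoids the first two cases for every [k]
    is a permutation of the [z_k] ([expectation_monomial_eq0]).  Each of the
    [d!] permutations contributes [G(z_1, ..., z_d)] by symmetry of the tensor
    ([multilinear_form_perm]).

    The product rule itself is the definition of independence when all the
    functions are indicators.  It extends to nonnegative functions by replacing
    one indicator at a time, through monotone approximation by simple functions
    ([independent_integral_prod_ge0]).  The two moments vanish because they are
    averages of a nontrivial character: a geometric sum over the roots of unity
    ([sum_conj_omegaX]), or the integral of [cos] and [sin] over whole periods
    ([expectationC_circle_conjX]). *)

(** * Expectation of complex random variables *)

Section ComplexExpectation.
Context {disp : measure_display} {T : measurableType disp} {R : realType}.
Context {P : probability T R}.
Implicit Types X Y : T -> R[i].

(** Componentwise measurability, matching the componentwise definition of
    [integrableC]; it avoids fixing a sigma-algebra on the codomain. *)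
Definition measurable_complex (X : T -> R[i]) : Prop :=
  measurable_fun setT (fun w => complex.Re (X w)) /\
  measurable_fun setT (fun w => complex.Im (X w)).

Lemma expectationCE X : expectationC P X =
  Complex (Rintegral P setT (fun w => complex.Re (X w)))
          (Rintegral P setT (fun w => complex.Im (X w))).
Proof. by rewrite /expectationC unlock. Qed.

Lemma complexReD (a b : R[i]) : complex.Re (a + b) = complex.Re a + complex.Re b.
Proof. by case: a => ? ?; case: b. Qed.

Lemma complexImD (a b : R[i]) : complex.Im (a + b) = complex.Im a + complex.Im b.
Proof. by case: a => ? ?; case: b. Qed.

Lemma complexReM (a b : R[i]) : complex.Re (a * b) =
  complex.Re a * complex.Re b - complex.Im a * complex.Im b.
Proof. by case: a => ? ?; case: b. Qed.

Lemma complexImM (a b : R[i]) : complex.Im (a * b) =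
  complex.Re a * complex.Im b + complex.Im a * complex.Re b.
Proof. by case: a => ? ?; case: b => ? ?. Qed.

Lemma complexReJ (a : R[i]) : complex.Re (a^*) = complex.Re a.
Proof. by case: a. Qed.

Lemma complexImJ (a : R[i]) : complex.Im (a^*) = - complex.Im a.
Proof. by case: a. Qed.

Lemma integrableC_measurable X : integrableC P X -> measurable_complex X.
Proof.
by case=> iR iI; split; apply/measurable_EFinP; apply: measurable_int; eassumption.
Qed.

Lemma integrableC0 : integrableC P (fun=> 0 : R[i]).
Proof. by split=> /=; apply: finite_measure_integrable_cst. Qed.

Lemma Rintegral_prob_cst (r : R) : Rintegral P setT (fun=> r) = r.
Proof.
rewrite Rintegral_cst// [X in fine X](_ : _ = 1%E) ?mulr1//.
exact: probability_setT.
Qed.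

Lemma expectationC_cst (c : R[i]) : expectationC P (fun=> c) = c.
Proof. by rewrite expectationCE !Rintegral_prob_cst; case: c. Qed.

Lemma integrableCD X Y : integrableC P X -> integrableC P Y ->
  integrableC P (fun w => X w + Y w).
Proof.
move=> [XR XI] [YR YI]; split.
  under eq_fun do rewrite complexReD EFinD.
  exact: integrableD.
under eq_fun do rewrite complexImD EFinD.
exact: integrableD.
Qed.

Lemma expectationCD X Y : integrableC P X -> integrableC P Y ->
  expectationC P (fun w => X w + Y w) = expectationC P X + expectationC P Y.
Proof.
move=> [XR XI] [YR YI]; rewrite !expectationCE.
under eq_Rintegral do rewrite complexReD.
under [X in Complex _ X]eq_Rintegral do rewrite complexImD.
by rewrite !RintegralD.
Qed.

Lemma integrableCZ (c : R[i]) X : integrableC P X ->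
  integrableC P (fun w => c * X w).
Proof.
move=> [XR XI]; split.
  under eq_fun do rewrite complexReM EFinB !EFinM.
  by apply: integrableB => //; apply: integrableZl.
under eq_fun do rewrite complexImM EFinD !EFinM.
by apply: integrableD => //; apply: integrableZl.
Qed.

Lemma integrable_mulrl (r : R) (u : T -> R) : P.-integrable setT (EFin \o u) ->
  P.-integrable setT (EFin \o (fun w => r * u w)).
Proof.
move=> iu; rewrite (_ : _ \o _ = fun w => r%:E * (u w)%:E)%E; last first.
  by apply/funext => w; rewrite /= EFinM.
exact: integrableZl.
Qed.

Lemma expectationCZ (c : R[i]) X : integrableC P X ->
  expectationC P (fun w => c * X w) = c * expectationC P X.
Proof.
move=> [XR XI]; rewrite !expectationCE.
under eq_Rintegral do rewrite complexReM.
under [X in Complex _ X]eq_Rintegral do rewrite complexImM.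
rewrite RintegralB// ?RintegralD//; try exact: integrable_mulrl.
by rewrite !RintegralZl//; case: c.
Qed.

Lemma integrableC_sum (I : Type) (s : seq I) (F : I -> T -> R[i]) :
  (forall i, integrableC P (F i)) ->
  integrableC P (fun w => \sum_(i <- s) F i w).
Proof.
move=> iF; elim: s => [|i s IH].
  by under eq_fun do rewrite big_nil; exact: integrableC0.
by under eq_fun do rewrite big_cons; exact: integrableCD.
Qed.

Lemma expectationC_sum (I : Type) (s : seq I) (F : I -> T -> R[i]) :
  (forall i, integrableC P (F i)) ->
  expectationC P (fun w => \sum_(i <- s) F i w) =
  \sum_(i <- s) expectationC P (F i).
Proof.
move=> iF; elim: s => [|i s IH].
  by under eq_fun do rewrite big_nil; rewrite big_nil expectationC_cst.
under eq_fun do rewrite big_cons.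
by rewrite expectationCD ?big_cons ?IH//; exact: integrableC_sum.
Qed.

Lemma integrableC_real (u : T -> R) :
  P.-integrable setT (EFin \o u) -> integrableC P (fun w => (u w)%:C%C).
Proof. by split=> //=; apply: finite_measure_integrable_cst. Qed.

Lemma expectationC_real (u : T -> R) :
  expectationC P (fun w => (u w)%:C%C) = (Rintegral P setT u)%:C%C.
Proof. by rewrite expectationCE Rintegral_prob_cst. Qed.

Lemma ae_eq_expectationC X Y : measurable_complex X -> measurable_complex Y ->
  {ae P, forall w, X w = Y w} -> expectationC P X = expectationC P Y.
Proof.
move=> [XR XI] [YR YI] XY; rewrite !expectationCE /Rintegral.
congr (Complex (fine _) (fine _)).
  apply: (ae_eq_integral (fun w => (complex.Re (Y w))%:E)) => //;
    try exact/measurable_EFinP.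
  by apply: filterS XY => w /= ->.
apply: (ae_eq_integral (fun w => (complex.Im (Y w))%:E)) => //;
    try exact/measurable_EFinP.
by apply: filterS XY => w /= ->.
Qed.

Lemma measurable_complex_mul X Y : measurable_complex X -> measurable_complex Y ->
  measurable_complex (fun w => X w * Y w).
Proof.
move=> [XR XI] [YR YI]; split.
  under eq_fun do rewrite complexReM.
  by apply: measurable_funB; apply: measurable_funM.
under eq_fun do rewrite complexImM.
by apply: measurable_funD; apply: measurable_funM.
Qed.

Lemma measurable_complex_conj X : measurable_complex X ->
  measurable_complex (fun w => (X w)^*).
Proof.
move=> [XR XI]; split; first by under eq_fun do rewrite complexReJ.
by under eq_fun do rewrite complexImJ; apply: measurableT_comp.
Qed.

Lemma measurable_complex_prod (I : Type) (s : seq I) (Q : pred I) (F : I -> T -> R[i]) :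
  (forall i, Q i -> measurable_complex (F i)) ->
  measurable_complex (fun w => \prod_(i <- s | Q i) F i w).
Proof.
move=> mF; elim: s => [|i s IH].
  by under eq_fun do rewrite big_nil; split; exact: measurable_cst.
under eq_fun do rewrite big_cons.
by case Qi: (Q i) => //; apply: measurable_complex_mul => //; exact: mF.
Qed.

Lemma measurable_complexX n X : measurable_complex X ->
  measurable_complex (fun w => X w ^+ n).
Proof.
move=> mX; rewrite (_ : (fun w => _) = fun w => \prod_(i < n) X w).
  exact: measurable_complex_prod.
by apply/funext => w; rewrite prodr_const card_ord.
Qed.

End ComplexExpectation.

(** * Expectation of a product of independent variables *)

Section Independence.
Context {disp disp' : measure_display} {T : measurableType disp}.
Context {T' : measurableType disp'} {R : realType} {P : probability T R}.
Local Open Scope ereal_scope.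
Import HBNNSimple.

Section TestFunctions.
Variables (X : {RV P >-> T'}) (Y : T -> R) (c : R).
Hypothesis mY : measurable_fun setT Y.
Hypothesis Y0 : forall w, (0 <= Y w)%R.
Hypothesis XY : forall S : set T', measurable S ->
  \int[P]_w (\1_S (X w) * Y w)%:E = \int[P]_w (\1_S (X w))%:E * c%:E.

Let mcomp (h : T' -> R) : measurable_fun setT h ->
  measurable_fun setT (fun w => (h (X w))%:E).
Proof. by move=> mh; apply/measurable_EFinP; exact: measurableT_comp. Qed.

Let mcompY (h : T' -> R) : measurable_fun setT h ->
  measurable_fun setT (fun w => (h (X w) * Y w)%:E).
Proof.
move=> mh; apply/measurable_EFinP; apply: measurable_funM => //.
exact: measurableT_comp.
Qed.

Let product_rule_nnsfun (h : {nnsfun T' >-> R}) :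
  \int[P]_w (h (X w) * Y w)%:E = \int[P]_w (h (X w))%:E * c%:E.
Proof.
set s := fset_set (range h).
have s0 i : (i < size s)%N -> (0 <= s`_i)%R.
  move=> /(mem_nth 0%R); rewrite in_fset_set// inE => -[x _ <-].
  exact: fun_ge0.
have mS i : measurable (h @^-1` [set s`_i]) by [].
under eq_integral do rewrite fimfunEord mulr_suml -sumEFin.
rewrite ge0_integral_sum//=; last 2 first.
- move=> i; apply: mcompY (fun x => s`_i * \1_(h @^-1` [set s`_i]) x)%R _.
  by apply: measurable_funM => //; exact: measurable_indic.
- by move=> i w _; rewrite lee_fin !mulr_ge0// s0.
under [in RHS]eq_integral do rewrite fimfunEord -sumEFin.
rewrite ge0_integral_sum//=; last 2 first.
- move=> i; apply: mcomp (fun x => s`_i * \1_(h @^-1` [set s`_i]) x)%R _.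
  by apply: measurable_funM => //; exact: measurable_indic.
- by move=> i w _; rewrite lee_fin !mulr_ge0// s0.
rewrite ge0_sume_distrl; last first.
  by move=> i _; apply: integral_ge0 => w _; rewrite lee_fin mulr_ge0// s0.
apply: eq_bigr => i _.
under eq_integral do rewrite -mulrA EFinM.
rewrite ge0_integralZl//; last 3 first.
- by apply: (mcompY (\1_(h @^-1` [set s`_i]))); exact: measurable_indic.
- by move=> w _; rewrite lee_fin mulr_ge0.
- by rewrite lee_fin s0.
under [in RHS]eq_integral do rewrite EFinM.
rewrite ge0_integralZl//; last 2 first.
- by apply: (mcomp (\1_(h @^-1` [set s`_i]))); exact: measurable_indic.
- by rewrite lee_fin s0.
by rewrite XY// muleA.
Qed.

(** A product rule against a fixed weight [Y] extends from indicators to all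
    nonnegative measurable functions, because both sides are linear and
    continuous along increasing sequences. *)
Lemma product_rule_ge0 (f : T' -> R) : measurable_fun setT f ->
  (forall z, (0 <= f z)%R) ->
  \int[P]_w (f (X w) * Y w)%:E = \int[P]_w (f (X w))%:E * c%:E.
Proof.
move=> mf f0.
have mEf : measurable_fun setT (EFin \o f) by exact/measurable_EFinP.
pose f_ := nnsfun_approx measurableT mEf.
have f_nd w : {homo (fun n => f_ n (X w)) : m n / (m <= n)%N >-> (m <= n)%R}.
  by move=> m n mn; exact/lefP/nd_nnsfun_approx.
have f_cvg w : (f_ n (X w))%:E @[n --> \oo] --> (f (X w))%:E.
  by apply: (@cvg_nnsfun_approx _ _ _ _ measurableT _ mEf) => // x _; rewrite lee_fin.
have L : \int[P]_w (f_ n (X w))%:E @[n --> \oo] --> \int[P]_w (f (X w))%:E.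
  under [X in _ --> X]eq_integral.
    by move=> w _; rewrite -(cvg_lim _ (f_cvg w))//; over.
  apply: cvg_monotone_convergence => //.
  - by move=> n; exact: mcomp.
  - by move=> n w _; rewrite lee_fin.
  - by move=> w _ m n mn; rewrite lee_fin; exact: f_nd.
have LY : \int[P]_w (f_ n (X w) * Y w)%:E @[n --> \oo] -->
          \int[P]_w (f (X w) * Y w)%:E.
  have f_cvgY w : (f_ n (X w) * Y w)%:E @[n --> \oo] --> (f (X w) * Y w)%:E.
    under eq_fun do rewrite EFinM.
    by rewrite EFinM; apply: cvgeZr => //; exact: f_cvg.
  under [X in _ --> X]eq_integral.
    by move=> w _; rewrite -(cvg_lim _ (f_cvgY w))//; over.
  apply: cvg_monotone_convergence => //.
  - by move=> n; exact: mcompY.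
  - by move=> n w _; rewrite lee_fin mulr_ge0.
  - by move=> w _ m n mn; rewrite lee_fin ler_wpM2r//; exact: f_nd.
apply: (cvg_unique _ LY) => //.
rewrite (_ : (fun _ => _) = fun n => \int[P]_w (f_ n (X w))%:E * c%:E).
  exact: cvgeZr.
by apply/funext => n; exact: product_rule_nnsfun.
Qed.

End TestFunctions.


Section ProductRule.
Variables (I : finType) (X : I -> {RV P >-> T'}).
Hypothesis iX : mutually_independent X.

Let product_rule_indic (S : I -> set T') : (forall i, measurable (S i)) ->
  \int[P]_w (\prod_i \1_(S i) (X i w))%:E = \prod_i \int[P]_w (\1_(S i) (X i w))%:E.
Proof.
move=> mS.
have mXS i : measurable (X i @^-1` S i).
  by rewrite -[X in measurable X]setTI; exact: measurable_funP.
pose B := \bigcap_(i in [set` [set: I]%SET]) (X i @^-1` S i).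
have E w : (\prod_i \1_(S i) (X i w))%R = \1_B w :> R.
  rewrite [RHS]indicE; have [wB|wB] := pselect (B w).
    rewrite mem_set// big1// => i _.
    by rewrite indicE mem_set//; apply: wB; rewrite /= inE.
  rewrite memNset//=; apply/eqP/prodf_eq0; apply: contrapT => nE; apply: wB.
  move=> i _ /=; apply: contrapT => nS; apply: nE.
  by exists i => //; rewrite indicE memNset.
under eq_integral do rewrite E.
rewrite integral_indic//; last by apply: fin_bigcap_measurable.
rewrite setIT; apply: (etrans (iX [set: I]%SET S _)) => //.
apply: eq_big => [i|i _]; first by rewrite inE.
rewrite -[RHS](_ : \int[P]_w (\1_(X i @^-1` S i) w)%:E = _)//.
by rewrite integral_indic// setIT.
Qed.

(** Induction on the number of factors that are not indicators.  For such a
    factor [k], the induction hypothesis applied with [F k] replaced by an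
    indicator is exactly the weighted rule required by [product_rule_ge0], the
    weight being the product of the other factors. *)
Lemma independent_integral_prod_ge0 (F : I -> T' -> R) :
  (forall i, measurable_fun setT (F i)) -> (forall i z, (0 <= F i z)%R) ->
  (forall i, \int[P]_w (F i (X i w))%:E < +oo) ->
  \int[P]_w (\prod_i F i (X i w))%:E = \prod_i \int[P]_w (F i (X i w))%:E.
Proof.
(* The set [setT] is generalized to a set [A] outside of which every factor is
   an indicator. *)
have [n nI] := ubnP #|[set: I]%SET|.
have : forall i, i \notin [set: I]%SET ->
    exists2 S, measurable S & F i = \1_S by move=> i; rewrite inE.
elim: n [set: I]%SET nI F => // n IH A nA F FA mF F0 Foo.
have [A0|[k kA]] := set_0Vmem A.
  have /choice[S FS] : forall i, exists S, measurable S /\ F i = \1_S.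
    by move=> i; have [|S mS ->] := FA i; [rewrite A0 inE|exists S].
  rewrite (_ : F = fun i => \1_(S i)); last by apply/funext => i; case: (FS i).
  by apply: product_rule_indic => i; case: (FS i).
pose Y w := (\prod_(i | i != k) F i (X i w))%R.
pose c := (\prod_(i | i != k) fine (\int[P]_w (F i (X i w))%:E))%R.
have Ffin i : \int[P]_w (F i (X i w))%:E \is a fin_num.
  by rewrite ge0_fin_numE// integral_ge0// => w _; rewrite lee_fin.
have cE : c%:E = \prod_(i | i != k) \int[P]_w (F i (X i w))%:E.
  rewrite /c -prodEFin; apply: eq_bigr => i _; rewrite fineK//.
transitivity (\int[P]_w (F k (X k w) * Y w)%:E).
  by apply: eq_integral => w _; rewrite (bigD1 k).
rewrite (bigD1 k)//= -cE; apply: product_rule_ge0 => //.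
- rewrite /Y; under eq_fun do rewrite -big_filter.
  by apply: measurable_prod => i _; exact: measurableT_comp.
- by move=> w; apply: prodr_ge0.
move=> S mS.
pose F' i := if i == k then \1_S else F i.
have F'kk : F' k = \1_S by rewrite /F' eqxx.
have F'k i : i != k -> F' i = F i by rewrite /F' => /negbTE ->.
have := IH (A :\ k)%SET _ F'; rewrite (bigD1 k)//= F'kk cE.
rewrite (eq_bigr (fun i => \int[P]_w (F i (X i w))%:E)); last first.
  by move=> i /F'k ->.
move=> <-.
- apply: eq_integral => w _; rewrite (bigD1 k)//= F'kk; congr (_ * _)%:E.
  by apply: eq_bigr => i /F'k ->.
- by move: nA; rewrite (cardsD1 k) kA.
- move=> i; rewrite !inE negb_and negbK /F'; have [_ _|ik /= iA] := eqVneq i k.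
    by exists S.
  exact: FA.
- move=> i; rewrite /F'; case: ifP => // _; exact: measurable_indic.
- by move=> i z; rewrite /F'; case: ifP.
- move=> i; rewrite /F'; case: ifP => // _.
  have mXS : measurable (X i @^-1` S).
    by rewrite -[X in measurable X]setTI; exact: measurable_funP.
  rewrite [X in X < _](_ : _ = P (X i @^-1` S)).
    exact: le_lt_trans (probability_le1 _ mXS) (ltry _).
  rewrite -[LHS](_ : \int[P]_w (\1_(X i @^-1` S) w)%:E = _)//.
  by rewrite integral_indic// setIT.
Qed.

End ProductRule.

End Independence.

Section ComplexIndependence.
Context {disp disp' : measure_display} {T : measurableType disp}.
Context {T' : measurableType disp'} {R : realType} {P : probability T R}.

(** The product rule is available for nonnegative factors only, so that a
    complex number is split into four nonnegative parts, with coefficients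
    [1], [-1], [i] and [-i]: [p.1] selects the imaginary part and [p.2] the
    negative part. *)
Definition part_coef (p : bool * bool) : R[i] := ((-1) ^+ p.2 * 'i%C ^+ p.1)%R.

Definition part (p : bool * bool) (z : R[i]) : R :=
  Num.max ((-1) ^+ p.2 * (if p.1 then complex.Im z else complex.Re z)) 0.

Lemma part_ge0 p z : (0 <= part p z)%R.
Proof. by rewrite le_max lexx orbT. Qed.

Lemma sum_part z : z = (\sum_p part_coef p * (part p z)%:C%C)%R.
Proof.
have max_sub (r : R) : (r = Num.max r 0 - Num.max (- r) 0)%R.
  have /orP[r0|r0] := le_total r 0.
    by rewrite max_r// max_l ?oppr_ge0// sub0r opprK.
  by rewrite max_l// max_r ?oppr_le0// subr0.
rewrite -(pair_bigA _ (fun b s => part_coef (b, s) * (part (b, s) z)%:C%C)%R)/=.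
rewrite !big_bool /part_coef /part /= !expr0 !expr1 !mul1r !mulN1r.
apply/eqP; rewrite eq_complex !(complexReD, complexImD, complexReM, complexImM) /=.
case: z => a b /=; apply/andP; split; apply/eqP.
  by rewrite [LHS](max_sub a); ring.
by rewrite [LHS](max_sub b); ring.
Qed.

Let integrable_part p (g : T -> R[i]) : integrableC P g ->
  P.-integrable setT (EFin \o (fun w => part p (g w))).
Proof.
move=> [gR gI].
have ip (r : T -> R) : P.-integrable setT (EFin \o r) ->
    P.-integrable setT (EFin \o (fun w => Num.max ((-1) ^+ p.2 * r w) 0)%R).
  move=> ir.
  have mr : measurable_fun setT r by apply/measurable_EFinP; exact: measurable_int ir.
  apply: le_integrable ir => //.
    apply/measurable_EFinP; apply: measurable_maxr => //.
    exact: measurable_funM.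
  move=> w _ /=; rewrite lee_fin ger0_norm; last by rewrite le_max lexx orbT.
  by rewrite ge_max normr_ge0 andbT (le_trans (ler_norm _))// normrMsign.
by rewrite /part; case: p.1; apply: ip.
Qed.

Variables (I : finType) (X : I -> {RV P >-> T'}).
Hypothesis iX : mutually_independent X.

(** Both sides are multilinear in the factors, and splitting every factor into
    its four nonnegative parts reduces the claim to
    [independent_integral_prod_ge0].  Integrability of the product comes for
    free, since the integral of each resulting product of nonnegative parts is
    a product of finite integrals. *)
Lemma independent_expectationC_prod (f : I -> T' -> R[i]) :
  (forall i, measurable_complex (f i)) ->
  (forall i, integrableC P (fun w => f i (X i w))) ->
  integrableC P (fun w => \prod_i f i (X i w))%R /\
  expectationC P (fun w => \prod_i f i (X i w))%R =
    (\prod_i expectationC P (fun w => f i (X i w)))%R.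
Proof.
move=> mf fi.
pose u (h : {ffun I -> bool * bool}) w := (\prod_i part (h i) (f i (X i w)))%R.
pose c (h : {ffun I -> bool * bool}) := (\prod_i part_coef (h i))%R.
have mp p i : measurable_fun setT (fun z => part p (f i z)).
  have [mR mI] := mf i.
  rewrite /part; apply: measurable_maxr => //; apply: measurable_funM => //.
  by case: p.1.
have pi0 h i : (\int[P]_w (part (h i) (f i (X i w)))%:E < +oo)%E.
  have /integrable_lty -> // := integrable_part (h i) _ (fi i).
have pfin h i : (\int[P]_w (part (h i) (f i (X i w)))%:E)%E \is a fin_num.
  by rewrite ge0_fin_numE// integral_ge0// => w _; rewrite lee_fin part_ge0.
have uE h : (\int[P]_w (u h w)%:E)%E =
    (\prod_i Rintegral P setT (fun w => part (h i) (f i (X i w))))%:E.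
  rewrite -prodEFin; under [RHS]eq_bigr do rewrite fineK//.
  apply: (independent_integral_prod_ge0 _ _ iX (fun i z => part (h i) (f i z))) => //.
  by move=> i z; exact: part_ge0.
have uint h : P.-integrable setT (EFin \o u h).
  apply/integrableP; split.
    apply/measurable_EFinP; apply: measurable_prod => i _.
    exact: (measurableT_comp (mp (h i) i)).
  rewrite (eq_integral (fun w => (u h w)%:E)); last first.
    by move=> w _; rewrite /= ger0_norm// prodr_ge0// => i _; exact: part_ge0.
  by rewrite uE ltry.
have E w : (\prod_i f i (X i w) = \sum_h c h * (u h w)%:C%C)%R.
  rewrite (eq_bigr _ (fun i _ => sum_part (f i (X i w)))) bigA_distr_bigA/=.
  by apply: eq_bigr => h _; rewrite big_split/= rmorph_prod.
have iu h : integrableC P (fun w => c h * (u h w)%:C%C)%R.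
  exact/integrableCZ/integrableC_real.
rewrite (_ : (fun _ => _) = fun w => (\sum_h c h * (u h w)%:C%C)%R); last first.
  by apply/funext => w; exact: E.
split; first exact: integrableC_sum.
rewrite expectationC_sum//.
transitivity (\prod_i \sum_p part_coef p *
    (Rintegral P setT (fun w => part p (f i (X i w))))%:C%C)%R; last first.
  apply: eq_bigr => i _.
  have ip p := integrable_part p _ (fi i).
  transitivity (expectationC P
    (fun w => \sum_p part_coef p * (part p (f i (X i w)))%:C%C)%R).
    rewrite expectationC_sum; last by move=> p; apply/integrableCZ/integrableC_real.
    apply: eq_bigr => p _; rewrite expectationCZ ?expectationC_real//.
    exact: integrableC_real.
  by congr expectationC; apply/funext => w; rewrite -sum_part.
rewrite bigA_distr_bigA/=; apply: eq_bigr => h _.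
rewrite expectationCZ; last exact: integrableC_real.
rewrite expectationC_real big_split/= -rmorph_prod; congr (_ * (_)%:C%C)%R.
by rewrite {1}/Rintegral uE.
Qed.

End ComplexIndependence.

(** * Measurability on the complex plane *)

Section BorelC.
Context {R : realType}.

(** Stated for an abstract additive functional of norm at most [1] so that it
    serves both the real and the imaginary part. *)
Lemma open_preimage_gt (u : R[i] -> R) (a : R) :
  (forall z y, u y - u z = u (y - z)) ->
  (forall z, (`|u z|%:C <= `|z|)%C) ->
  open [set z : R[i]^o | a < u z].
Proof.
move=> uB u_le; rewrite openE => z /= az.
apply/nbhs_ballP; exists (u z - a)%:C%C => /=.
  by rewrite ltcR subr_gt0.
move=> y; rewrite -ball_normE /= => zy.
have : (`|u (z - y)|%:C < (u z - a)%:C)%C by exact: le_lt_trans zy.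
rewrite ltcR -uB => /(le_lt_trans (ler_norm _)).
by rewrite ltrD2l ltrN2.
Qed.

Lemma measurable_borelC_id : measurable_complex (fun z : borelC R => (z : R[i])).
Proof.
have mu (u : R[i] -> R) : (forall z y, u y - u z = u (y - z)) ->
    (forall z, (`|u z|%:C <= `|z|)%C) ->
    measurable_fun [set: borelC R] (u : borelC R -> R).
  move=> uB u_le.
  apply: (measurability _ (RGenOInfty.measurableE R)) => _ [_ [a ->] <-].
  rewrite setTI; apply: sub_sigma_algebra.
  rewrite (_ : _ @^-1` _ = [set z : R[i]^o | a < u z]).
    exact: open_preimage_gt.
  by apply/seteqP; split => z /=; rewrite in_itv/= andbT.
split; apply: mu => [z y|z].
- by rewrite raddfB.
- exact: normc_ge_Re.
- by case: z => ? ?; case: y.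
- case: z => a b; rewrite normc_def lecR /= -sqrtr_sqr ler_wsqrtr//.
  by rewrite lerDr sqr_ge0.
Qed.

Lemma continuous_real_complex : continuous (fun x : R => x%:C%C : R[i]^o).
Proof.
move=> x; apply/cvgrPdist_lt => e e0.
have eE : e = (complex.Re e)%:C%C by rewrite RRe_real// gtr0_real.
rewrite eE; near=> y.
rewrite -raddfB/= normc_def/= expr0n addr0 sqrtr_sqr ltcR.
near: y; apply: (@cvgr_dist_lt _ _ _ _ _ id x); first exact: cvg_id.
by move: e0; rewrite eE ltcR.
Unshelve. all: by end_near. Qed.

Lemma measurable_continuous_borelC (f : R -> R[i]^o) : continuous f ->
  measurable_fun setT (f : R -> borelC R).
Proof.
move=> /continuousP cf.
refine (@measurability _ _ _ (borelC R) setT f (@open R[i]^o) _ _) => //.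
move=> _ [B oB <-]; rewrite setTI; apply: open_measurable; exact: cf.
Qed.

Lemma measurable_set1_borelC (c : R[i]) : measurable ([set c] : set (borelC R)).
Proof.
have [mR mI] := measurable_borelC_id.
rewrite (_ : [set c] =
    ((fun z : borelC R => complex.Re (z : R[i])) @^-1` [set complex.Re c]) `&`
    ((fun z : borelC R => complex.Im (z : R[i])) @^-1` [set complex.Im c])).
  by apply: measurableI; rewrite -[X in measurable X]setTI;
    [apply: mR|apply: mI].
apply/seteqP; split => [z ->//|z [/= ]].
by case: z => a b; case: c => a' b' /= -> ->.
Qed.

End BorelC.

(** * The unit circle and its roots of unity *)

Section UnitCircle.
Context {R : realType}.

Lemma expi0 : expi 0 = 1 :> R[i].
Proof. by rewrite /expi cos0 sin0. Qed.

Lemma expiD (s t : R) : expi (s + t) = expi s * expi t.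
Proof.
apply/eqP; rewrite eq_complex complexReM complexImM /expi/= cosD sinD.
by rewrite eqxx/= [X in _ == X]addrC.
Qed.

Lemma expiX (t : R) k : expi t ^+ k = expi (t *+ k).
Proof. by elim: k => [|k IH]; rewrite ?expi0// exprS mulrS expiD IH. Qed.

Lemma expiJ (t : R) : (expi t)^* = expi (- t).
Proof.
by apply/eqP; rewrite eq_complex complexReJ complexImJ /expi/= cosN sinN !eqxx.
Qed.

Lemma expi_conjK (t : R) : expi t * (expi t)^* = 1.
Proof. by rewrite expiJ -expiD subrr expi0. Qed.

Lemma expi_2pi : expi (pi *+ 2) = 1 :> R[i].
Proof. by rewrite /expi cos2pi sin2pi. Qed.

Lemma expi_neq1 (t : R) : 0 < t < pi *+ 2 -> expi t != 1.
Proof.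
move=> /andP[t0 t2]; apply/eqP => -[].
have -> : t = (t / 2) *+ 2 by rewrite -mulr_natr divfK.
have s0 : 0 < sin (t / 2).
  apply: sin_gt0_pi; rewrite divr_gt0//= ltr_pdivrMr//.
  by rewrite mulr_natr.
move=> c1 _.
have := cos2Dsin2 (t / 2); move: c1; rewrite cos_mulr2n -mulr_natr => c1.
have : 0 < sin (t / 2) ^+ 2 by rewrite exprn_gt0.
by lra.
Qed.

Section Omega.
Variable m : nat.
Hypothesis m0 : (0 < m)%N.

Lemma omegaX k : omega R m ^+ k = expi (pi *+ 2 * (k%:R / m%:R)).
Proof. by rewrite /omega expiX -[_ *+ k]mulr_natr mulrAC mulrA. Qed.

Lemma omegaXm : omega R m ^+ m = 1.
Proof. by rewrite omegaX divff ?mulr1 ?expi_2pi// pnatr_eq0 -lt0n. Qed.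

Lemma omegaX_neq1 k : (0 < k < m)%N -> omega R m ^+ k != 1.
Proof.
move=> /andP[k0 km]; rewrite omegaX; apply: expi_neq1.
have p0 := two_pi_gt0 R.
rewrite mulr_gt0//= ?divr_gt0 ?ltr0n//.
by rewrite gtr_pMr// ltr_pdivrMr ?ltr0n// mul1r ltr_nat.
Qed.

Lemma omega_conjK : omega R m * (omega R m)^* = 1.
Proof. exact: expi_conjK. Qed.

Lemma omegaX_conjK k : omega R m ^+ k * (omega R m ^+ k)^* = 1.
Proof. by rewrite rmorphXn -exprMn omega_conjK expr1n. Qed.

Lemma omegaX_inj (k l : 'I_m) : omega R m ^+ k = omega R m ^+ l -> k = l.
Proof.
wlog kl : k l / (k <= l)%N => [H E|E].
  by have /orP[/H|/H] := leq_total k l => ->.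
apply/val_inj/eqP => /=; rewrite eqn_leq kl /= leqNgt; apply/negP => kl'.
have lk : (0 < l - k < m)%N.
  by rewrite subn_gt0 kl' (leq_ltn_trans (leq_subr _ _)).
have /negP := omegaX_neq1 _ lk; apply; apply/eqP.
have := omegaX_conjK k; rewrite {1}E -[in X in X * _](subnK kl) exprD -mulrA.
by rewrite omegaX_conjK mulr1.
Qed.

(** A geometric sum whose ratio is an [m]-th root of unity other than [1]. *)
Lemma sum_conj_omegaX j : (0 < j < m)%N ->
  \sum_(k < m) ((omega R m ^+ k)^*) ^+ j = 0.
Proof.
move=> jm; pose z := (omega R m ^+ j)^*.
have z1 : z - 1 != 0.
  rewrite subr_eq0; apply: contra (omegaX_neq1 j jm) => /eqP zE.
  by rewrite -[X in X == _]conjCK -/z zE rmorph1.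
apply: (mulfI z1); rewrite mulr0.
under eq_bigr do rewrite -rmorphXn -exprM mulnC exprM rmorphXn -/z.
by rewrite -subrX1 -rmorphXn -exprM mulnC exprM omegaXm expr1n rmorph1 subrr.
Qed.

End Omega.

Lemma continuous_expi : continuous (@expi R : R -> R[i]^o).
Proof.
have -> : (@expi R : R -> R[i]^o) =
    (fun t => (cos t)%:C%C + 'i%C * (sin t)%:C%C).
  by apply/funext => t; exact: (complexE (expi t)).
move=> t; apply: cvgD.
  apply: (@continuous_comp _ _ _ cos (fun x : R => x%:C%C : R[i]^o)).
    exact: continuous_cos.
  exact: continuous_real_complex.
apply: cvgM; first exact: cvg_cst.
apply: (@continuous_comp _ _ _ sin (fun x : R => x%:C%C : R[i]^o)).
  exact: continuous_sin.
exact: continuous_real_complex.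
Qed.

End UnitCircle.

(** * Moments of the uniform law on the roots of unity *)

Lemma ae_bounded_integrable {disp : measure_display} {T : measurableType disp}
  {R : realType} {P : probability T R} (u : T -> R) : measurable_fun setT u ->
  {ae P, forall w, `|u w| <= 1} -> P.-integrable setT (EFin \o u).
Proof.
move=> mu u1; apply/integrableP; split; first exact/measurable_EFinP.
apply: (@le_lt_trans _ _ (1 * P setT)%E).
  apply: integral_le_bound => //; first exact/measurable_EFinP.
  by apply: filterS u1 => w u1 _; rewrite lee_fin.
by rewrite mul1e (le_lt_trans (probability_le1 _ _)) ?ltry.
Qed.

Section UniformLaw.
Context {disp : measure_display} {T : measurableType disp} {R : realType}.
Context {P : probability T R}.

(** The variables at hand have modulus [1] only almost surely: on a null set they
    may be arbitrarily large, hence the almost everywhere bound. *)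
Lemma unimodular_integrableC (Y : T -> R[i]) : measurable_complex Y ->
  {ae P, forall w, Y w * (Y w)^* = 1} -> integrableC P Y.
Proof.
move=> [mR mI] Y1.
have bound w : Y w * (Y w)^* = 1 ->
    `|complex.Re (Y w)| <= 1 /\ `|complex.Im (Y w)| <= 1.
  case: (Y w) => a b /eqP; rewrite eq_complex complexReM complexReJ complexImJ /=.
  move=> /andP[/eqP ab _].
  by split; rewrite -sqrtr_sqr -[leRHS]sqrtr1 ler_wsqrtr//;
    have := sqr_ge0 a; have := sqr_ge0 b; nra.
split; apply: ae_bounded_integrable => //; apply: filterS Y1 => w /bound[] //.
Qed.

Variable X : {RV P >-> borelC R}.

Lemma measurable_RV_complex : measurable_complex (fun w => (X w : R[i])).
Proof.
have [mR mI] := @measurable_borelC_id R.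
split.
  exact: (measurableT_comp mR).
exact: (measurableT_comp mI).
Qed.

Section Finite.
Variable m : nat.
Hypothesis m0 : (0 < m)%N.
Hypothesis unif : uniform_on_Omega (Some m) X.

Let hit (k : 'I_m) : set T := X @^-1` [set omega R m ^+ k].

Let measurable_hit k : measurable (hit k).
Proof.
rewrite -[X in measurable X]setTI; apply: measurable_funP => //.
exact: measurable_set1_borelC.
Qed.

Let measure_hit k : P (hit k) = (m%:R^-1)%:E.
Proof. by apply: unif; exists k => /=. Qed.

Let trivIset_hit : trivIset setT hit.
Proof.
move=> k l _ _ [w [/= kw lw]]; apply: (omegaX_inj _ m0).
exact: etrans (esym kw) lw.
Qed.

(** The law is prescribed on the roots of unity only, but these [m] distinct
    points of mass [1/m] exhaust the total mass. *)
Lemma ae_roots_of_unity :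
  {ae P, forall w, exists k : 'I_m, (X w : R[i]) = omega R m ^+ k}.
Proof.
pose B := \big[setU/set0]_(k < m) hit k.
have mB : measurable B by exact: bigsetU_measurable.
exists (~` B); split.
- exact: measurableC.
- rewrite probability_setC//.
  rewrite [X in (_ - X)%E](_ : _ = 1%E) ?subee//.
  rewrite /B (@measure_bigsetU_ord _ _ _ P)//.
  rewrite (eq_bigr (fun=> (m%:R^-1)%:E)) => [|k _]; last exact: measure_hit.
  rewrite sumEFin sumr_const card_ord -[_ *+ m]mulr_natr mulVf//.
  by rewrite pnatr_eq0 -lt0n.
- move=> w /= nw Bw; apply: nw; move: Bw; rewrite /B.
  by elim/big_ind: _ => [//|A C hA hC [/hA|/hC]//|k _ Xw]; exists k.
Qed.

(** Almost surely, [f (X w)] is the finite combination of the indicators of the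
    events [hit k] with coefficients the values of [f] at the roots of unity. *)
Lemma expectationC_finite (f : borelC R -> R[i]) : measurable_complex f ->
  expectationC P (fun w => f (X w)) =
  m%:R^-1 * \sum_(k < m) f (omega R m ^+ k).
Proof.
move=> [mR mI].
have ih k : integrableC P (fun w => (\1_(hit k) w)%:C%C : R[i]).
  by apply: integrableC_real; apply: integrable_indic.
pose Y w : R[i] := \sum_(k < m) f (omega R m ^+ k) * (\1_(hit k) w)%:C%C.
have iY : integrableC P Y by apply: integrableC_sum => k; exact: integrableCZ.
transitivity (expectationC P Y).
  apply: ae_eq_expectationC.
  - by split; [apply: (measurableT_comp mR)|apply: (measurableT_comp mI)].
  - exact: integrableC_measurable iY.
  apply: filterS ae_roots_of_unity => w [k Xw].
  rewrite /Y (bigD1 k)//= big1 ?addr0 => [|l lk].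
    by rewrite indicE mem_set ?mulr1// -Xw.
  rewrite indicE memNset ?mulr0// /hit /= Xw => /(omegaX_inj _ m0) kl.
  by rewrite kl eqxx in lk.
rewrite /Y expectationC_sum; last by move=> k; exact: integrableCZ.
rewrite mulr_sumr; apply: eq_bigr => k _; rewrite expectationCZ// mulrC.
congr (_ * _); rewrite expectationC_real /Rintegral integral_indic// setIT.
by rewrite [X in fine X]measure_hit /= fmorphV rmorph_nat.
Qed.

End Finite.

Section Circle.
Hypothesis unif : uniform_on_Omega None X.
Local Notation U := (uniform_prob (two_pi_gt0 R)).

Lemma measurable_expi : measurable_fun setT (@expi R : R -> borelC R).
Proof. exact: measurable_continuous_borelC (@continuous_expi R). Qed.

(** Change of variables: [X] under [P] and [expi] under the uniform law on
    [[0, 2 pi]] have the same image measure. *)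
Lemma integral_circle (u : borelC R -> R) : measurable_fun setT u ->
  P.-integrable setT (fun w => (u (X w))%:E) ->
  U.-integrable setT (fun t => (u (expi t))%:E) ->
  (\int[P]_w (u (X w))%:E = \int[U]_t (u (expi t))%:E)%E.
Proof.
move=> mu iu iU.
have mE : measurable_fun setT (EFin \o u) by exact/measurable_EFinP.
transitivity (\int[pushforward P X]_z (EFin \o u) z)%E.
  by rewrite integral_pushforward//; exact: measurable_funP.
transitivity (\int[pushforward U (@expi R : R -> borelC R)]_z (EFin \o u) z)%E.
  by apply: eq_measure_integral => [|mexp A mA _]; [exact: measurable_expi|exact: unif].
rewrite integral_pushforward//; exact: measurable_expi.
Qed.

(** The fundamental theorem of calculus on one period.  It is applied to
    [1 + h], which is nonnegative, so that [integral_uniform] turns the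
    expectation into a Lebesgue integral over [[0, 2 pi]]. *)
Lemma integral_uniform_derive (h H : R -> R) : continuous h ->
  (forall t, `|h t| <= 1) -> (forall t : R, is_derive t 1 H (h t)) ->
  H (pi *+ 2) = H 0 -> (\int[U]_t (h t)%:E)%E = 0%E.
Proof.
move=> ch h1 dH H2pi.
have mh : measurable_fun setT h by exact: continuous_measurable_fun.
have ih : U.-integrable setT (EFin \o h).
  by apply: ae_bounded_integrable => //; exact: aeW.
have i1 : U.-integrable setT (EFin \o cst 1) by exact: finite_measure_integrable_cst.
have : (\int[U]_t (1 + h t)%:E)%E = 1%E.
  rewrite integral_uniform; last 2 first.
  - by apply/measurable_EFinP; exact: measurable_funD.
  - by move=> t; rewrite lee_fin -lerBlDl sub0r (le_trans _ (lerNnormlW (h1 t))).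
  (* A primitive of [1 + h], which grows by exactly [2 pi] over the period. *)
  pose F t := t + H t.
  have dF (t : R) : is_derive t 1 F (1 + h t) by exact: is_deriveD.
  have cF : continuous F.
    by move=> t; apply: differentiable_continuous; apply/derivable1_diffP.
  rewrite (@continuous_FTC2 _ _ F)//.
  - rewrite /F H2pi -EFinB -EFinM; congr _%:E.
    rewrite subr0 add0r addrK mulVf// gt_eqF//; exact: two_pi_gt0.
  - exact: two_pi_gt0.
  - by apply: continuous_subspaceT => t; apply: cvgD; [exact: cvg_cst|exact: ch].
  - split => [t _ //||].
    + exact/cvg_at_right_filter/cF.
    + exact/cvg_at_left_filter/cF.
  - by move=> t _; rewrite derive1E; apply: derive_val.
rewrite integralD_EFin// [X in (X + _)%E](_ : _ = 1%E); last first.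
  by rewrite integral_cst// mul1e; exact: probability_setT.
have := integrable_fin_num measurableT ih.
case: (integral _ _ _) => //= r _ [] /eqP.
by rewrite -subr_eq0 addrAC subrr add0r => /eqP ->.
Qed.

Lemma ae_circle : {ae P, forall w, (X w : R[i]) * (X w)^* = 1}.
Proof.
have mid := @measurable_borelC_id R.
have [mN _] := measurable_complex_mul _ _ mid (measurable_complex_conj _ mid).
pose B : set (borelC R) := (fun z => complex.Re ((z : R[i]) * z^*)) @^-1` [set 1].
have mB : measurable B by rewrite -[B]setTI; exact: mN.
have BE (z : borelC R) : B z <-> (z : R[i]) * z^* = 1.
  split; last by rewrite /B /= => ->.
  case: z => a b; rewrite /B /= => ab.
  apply/eqP; rewrite eq_complex; apply/andP; split; first exact/eqP.
  by apply/eqP => /=; ring.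
exists (X @^-1` (~` B)); split.
- by rewrite -[X in measurable X]setTI; apply: measurable_funP => //; exact: measurableC.
- transitivity (U (@expi R @^-1` (~` B))); first by apply: unif; exact: measurableC.
  rewrite (_ : _ @^-1` _ = set0) ?measure0//.
  apply/seteqP; split => // t /= + ; apply; apply/BE; exact: expi_conjK.
- by move=> w /= nw; apply: contra_not nw => /BE.
Qed.

Lemma expectationC_circle_conjX j : (0 < j)%N ->
  expectationC P (fun w => ((X w : R[i])^*) ^+ j) = 0.
Proof.
move=> j0.
have expiJX t : ((expi t : R[i])^*) ^+ j = expi (- (j%:R * t)).
  by rewrite expiJ expiX mulNrn mulr_natl.
have mf := measurable_complexX j _ (measurable_complex_conj _ (@measurable_borelC_id R)).
have [iR iI] : integrableC P (fun w => ((X w : R[i])^*) ^+ j).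
  apply: unimodular_integrableC.
    exact: measurable_complexX (measurable_complex_conj _ measurable_RV_complex).
  apply: filterS ae_circle => w Xw.
  rewrite -[RHS](expr1n _ j) -Xw exprMn mulrC; congr (_ * _).
  by rewrite -rmorphXn; exact: conjCK.
have dmul (t : R) : is_derive t 1 (fun s : R => j%:R * s) j%:R.
  by rewrite -[X in is_derive _ _ _ X](mulr1 (j%:R : R)); exact: is_deriveZ.
have cmul : continuous (fun s : R => j%:R * s).
  by move=> s; apply: cvgM; [exact: cvg_cst|exact: cvg_id].
have j_neq0 : j%:R != 0 :> R by rewrite pnatr_eq0 -lt0n.
have dsin (t : R) : is_derive t 1 (j%:R^-1 \*: (sin \o (fun s => j%:R * s)))
    (cos (j%:R * t)).
  have ds := is_derive1_comp (is_derive_sin (j%:R * t)) (dmul t).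
  rewrite -[X in is_derive _ _ _ X](mulKf j_neq0) [_ * cos _]mulrC.
  exact: is_deriveZ.
have dcos (t : R) : is_derive t 1 (j%:R^-1 \*: (cos \o (fun s => j%:R * s)))
    (- sin (j%:R * t)).
  have ds := is_derive1_comp (is_derive_cos (j%:R * t)) (dmul t).
  rewrite -[X in is_derive _ _ _ X](mulKf j_neq0) [_ * - sin _]mulrC.
  exact: is_deriveZ.
have expi2pi : expi (j%:R * (pi *+ 2)) = 1 :> R[i].
  by rewrite mulr_natl -expiX expi_2pi expr1n.
have cos_end : cos (j%:R * (pi *+ 2)) = 1 :> R by case: expi2pi.
have sin_end : sin (j%:R * (pi *+ 2)) = 0 :> R by case: expi2pi.
have ccos : continuous (fun t : R => cos (j%:R * t)).
  by move=> t; apply: (@continuous_comp _ _ _ _ cos); [exact: cmul|exact: continuous_cos].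
have csin : continuous (fun t : R => - sin (j%:R * t)).
  move=> t; apply: cvgN.
  by apply: (@continuous_comp _ _ _ _ sin); [exact: cmul|exact: continuous_sin].
have cos1 (t : R) : `|cos (j%:R * t)| <= 1 by rewrite ler_norml cos_geN1 cos_le1.
have sin1 (t : R) : `|- sin (j%:R * t)| <= 1.
  by rewrite normrN ler_norml sin_geN1 sin_le1.
have reE t : complex.Re ((expi t : R[i])^* ^+ j) = cos (j%:R * t).
  by rewrite expiJX /= cosN.
have imE t : complex.Im ((expi t : R[i])^* ^+ j) = - sin (j%:R * t).
  by rewrite expiJX /= sinN.
have iU (h : R -> R) : continuous h -> (forall t, `|h t| <= 1) ->
    U.-integrable setT (EFin \o h).
  move=> ch h1; apply: ae_bounded_integrable; first exact: continuous_measurable_fun.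
  exact: aeW.
rewrite expectationCE /Rintegral.
rewrite (@integral_circle (fun z => complex.Re ((z : R[i])^* ^+ j)))//; last 2 first.
- by case: mf.
- by under eq_fun do rewrite reE; exact: iU.
rewrite (@integral_circle (fun z => complex.Im ((z : R[i])^* ^+ j)))//; last 2 first.
- by case: mf.
- by under eq_fun do rewrite imE; exact: iU.
under eq_integral do rewrite reE.
under [X in Complex _ (fine X)]eq_integral do rewrite imE.
rewrite (integral_uniform_derive _ _ ccos cos1 dsin); last first.
  by rewrite /= sin_end mulr0 sin0.
rewrite (integral_uniform_derive _ _ csin sin1 dcos)//.
by rewrite /= cos_end mulr0 cos0.
Qed.

End Circle.
Section AnyOrder.
Variable m : option nat.
Hypothesis hm : forall k : nat, m = Some k -> (3 <= k)%N.
Hypothesis unif : uniform_on_Omega m X.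

Lemma ae_unimodular : {ae P, forall w, (X w : R[i]) * (X w)^* = 1}.
Proof.
case: m hm unif => [k|] h u; last exact: ae_circle.
have k0 : (0 < k)%N by rewrite (leq_trans _ (h _ erefl)).
by apply: filterS (ae_roots_of_unity _ k0 u) => w [l ->]; exact: omegaX_conjK.
Qed.

Lemma expectationC_conjX j : (0 < j < 3)%N ->
  expectationC P (fun w => ((X w : R[i])^*) ^+ j) = 0.
Proof.
move=> /andP[j0 j3]; case: m hm unif => [k|] h u; last exact: expectationC_circle_conjX.
have k3 := h _ erefl; have k0 : (0 < k)%N by rewrite (leq_trans _ k3).
rewrite (expectationC_finite _ k0 u (fun z => ((z : R[i])^*) ^+ j)).
  by rewrite sum_conj_omegaX ?mulr0// j0 (leq_trans j3 k3).
exact/measurable_complexX/measurable_complex_conj/measurable_borelC_id.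
Qed.

End AnyOrder.
End UniformLaw.

(** * Expansion of a symmetric multilinear form *)

Section Multilinear.
Variable C : numClosedFieldType.

(** Distributivity: each of the [d] slots chooses a summand, and [phi] records
    the choices. *)
Lemma multilinear_form_sum (N d : nat) (G : tensor C N d) (K : finType)
    (a : K -> C) (z : K -> 'cV[C]_N) :
  multilinear_form G (fun=> \sum_c a c *: z c) =
  \sum_(phi : {ffun 'I_d -> K})
    (\prod_s a (phi s)) * multilinear_form G (fun s => z (phi s)).
Proof.
rewrite /multilinear_form.
under [RHS]eq_bigr do rewrite mulr_sumr.
rewrite exchange_big/=; apply: eq_bigr => i _.
under eq_bigr do rewrite summxE.
rewrite (bigA_distr_bigA (fun k c => (a c *: z c) (i k) 0)) mulr_sumr/=.
apply: eq_bigr => phi _; rewrite mulrCA -big_split/=; congr (_ * _).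
by apply: eq_bigr => s _; rewrite mxE.
Qed.

Lemma multilinear_form_perm (N d : nat) (G : tensor C N d)
    (z : 'I_d -> 'cV[C]_N) (s : 'S_d) :
  (forall (s : 'S_d) (i : {ffun 'I_d -> 'I_N}), G [ffun k => i (s k)] = G i) ->
  multilinear_form G (fun k => z (s k)) = multilinear_form G z.
Proof.
move=> symG; rewrite /multilinear_form.
rewrite (reindex (fun i : {ffun 'I_d -> 'I_N} => [ffun k => i (s k)])) /=; last first.
  by exists (fun i : {ffun 'I_d -> 'I_N} => [ffun k => i ((s^-1)%g k)]) => i _;
    apply/ffunP => k; rewrite !ffunE ?permK ?permKV.
apply: eq_bigr => i _; rewrite symG; congr (_ * _).
rewrite [RHS](reindex_inj (@perm_inj _ s)).
by apply: eq_bigr => k _; rewrite ffunE.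
Qed.

(** Conjugation exchanges the two blocks of the stacked vector, so that the
    coefficient [conj (xi k)] is carried by the swapped conjugate vector. *)
Lemma col_mx_conj_sum (n d : nat) (xi : 'I_d -> C) (x y : 'I_d -> 'cV[C]_n) :
  let v := \sum_k (conj_vec (xi k *: x k) + xi k *: y k) in
  col_mx (conj_vec v) v =
  \sum_(c : 'I_d * bool)
    (if c.2 then xi c.1 else (xi c.1)^*) *:
    (if c.2 then col_mx (x c.1) (y c.1)
     else col_mx (conj_vec (y c.1)) (conj_vec (x c.1))).
Proof.
move=> v.
rewrite -(pair_bigA _ (fun k (b : bool) => (if b then xi k else (xi k)^*) *:
    (if b then col_mx (x k) (y k) else col_mx (conj_vec (y k)) (conj_vec (x k)))))/=.
have addE (p : nat) (A B : 'cV[C]_p) i : (A + B) i 0 = A i 0 + B i 0 by rewrite mxE.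
have scaleE (p : nat) b (A : 'cV[C]_p) i : (b *: A) i 0 = b * A i 0 by rewrite mxE.
apply/colP => i; rewrite summxE.
case: (split_ordP i) => j ->; rewrite ?col_mxEu ?col_mxEd.
  rewrite mxE summxE rmorph_sum; apply: eq_bigr => k _.
  rewrite big_bool /= !addE !scaleE !col_mxEu !mxE [LHS]rmorphD.
  by congr (_ + _); [exact: conjCK|exact: rmorphM].
rewrite summxE; apply: eq_bigr => k _.
by rewrite big_bool /= !addE !scaleE !col_mxEd !mxE rmorphM addrC.
Qed.

End Multilinear.

(** * Mixed moments and the polarization identity *)

Section MixedMoments.
Context {disp : measure_display} {T : measurableType disp} {R : realType}.
Context {P : probability T R}.
Variables (d : nat) (m : option nat).
Hypothesis hm : forall k : nat, m = Some k -> (3 <= k)%N.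
Variable xi : 'I_d -> {RV P >-> borelC R}.
Hypothesis hunif : forall k, uniform_on_Omega m (xi k).

Implicit Types phi : {ffun 'I_d -> 'I_d * bool}.

(** The part of the [phi]-term of the expansion that depends on [xi k]: the
    prefactor [z^*], and one factor for each slot to which [phi] assigns the
    index [k], conjugated when [phi] chooses the swapped vector. *)
Definition monomial phi (k : 'I_d) (z : R[i]) : R[i] :=
  z^* * \prod_(s | (phi s).1 == k) (if (phi s).2 then z else z^*).

Lemma measurable_monomial phi k :
  measurable_complex (fun z : borelC R => monomial phi k (z : R[i])).
Proof.
have mid := @measurable_borelC_id R.
have mJ := measurable_complex_conj _ mid.
apply: measurable_complex_mul => //.
apply: measurable_complex_prod => s _.
by case: (phi s).2.
Qed.

Lemma monomial_unimodular phi k (z : R[i]) : z * z^* = 1 ->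
  monomial phi k z * (monomial phi k z)^* = 1.
Proof.
move=> z1; have zJ : z^* * z^*^* = 1 by rewrite conjCK mulrC.
rewrite /monomial [X in _ * X]rmorphM mulrACA zJ mul1r.
rewrite [X in _ * X]rmorph_prod -big_split big1// => s _.
by case: ifP.
Qed.

Lemma integrableC_monomial phi k :
  integrableC P (fun w => monomial phi k (xi k w)).
Proof.
have [mR mI] := measurable_monomial phi k.
apply: unimodular_integrableC.
  by split; [apply: (measurableT_comp mR)|apply: (measurableT_comp mI)].
apply: filterS (ae_unimodular _ _ hm (hunif k)) => w.
exact: monomial_unimodular.
Qed.

(** The surviving choices: slot [k] receives the unconjugated vector [s k]. *)
Definition perm_true (s : 'S_d) : {ffun 'I_d -> 'I_d * bool} :=
  [ffun k => (s k, true)].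

Lemma perm_true_inj : injective perm_true.
Proof.
move=> s t /ffunP st; apply/permP => k.
by have := st k; rewrite !ffunE => -[].
Qed.

Lemma expectation_monomial_perm (s : 'S_d) k :
  expectationC P (fun w => monomial (perm_true s) k (xi k w)) = 1.
Proof.
have [mR mI] := measurable_monomial (perm_true s) k.
rewrite -(@expectationC_cst _ _ _ P 1); apply: ae_eq_expectationC.
- by split; [apply: (measurableT_comp mR)|apply: (measurableT_comp mI)].
- by split; exact: measurable_cst.
apply: filterS (ae_unimodular _ _ hm (hunif k)) => w Xw.
rewrite /monomial (big_pred1 ((s^-1)%g k)) => [|t]; last first.
  by rewrite ffunE /= -(inj_eq (@perm_inj _ s)) permKV.
by rewrite ffunE /= mulrC.
Qed.

(** Either some index [k] is never chosen, and its monomial is [conj (xi k)]; or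
    the choice of indices is a bijection by counting, and a slot with a
    conjugated choice gives the monomial [conj (xi k) ^ 2]. *)
Lemma expectation_monomial_eq0 phi : phi \notin [set perm_true s | s : 'S_d]%SET ->
  exists k, expectationC P (fun w => monomial phi k (xi k w)) = 0.
Proof.
move=> nphi.
pose f s := (phi s).1.
have [/forallP surj|/forallPn[k nk]] := boolP [forall k, k \in codom f]; last first.
  exists k; rewrite -(@expectationC_conjX _ _ _ P _ _ hm (hunif k) 1)//.
  congr expectationC; apply/funext => w.
  rewrite /monomial big_pred0 ?mulr1 ?expr1// => s.
  by apply: contraNF nk => /eqP <-; exact: codom_f.
have finj : injective f.
  have /image_injP fi : #|codom f| == #|'I_d|.
    by apply/eqP/eq_card => k; rewrite surj.
  by move=> s t; apply: fi.
have [/forallP tt|/forallPn[s ns]] := boolP [forall s, (phi s).2].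
  case/negP: nphi; apply/imsetP; exists (perm finj) => //.
  apply/ffunP => s; rewrite ffunE permE /f.
  by have := tt s; case: (phi s) => ? [].
exists (f s); rewrite -(@expectationC_conjX _ _ _ P _ _ hm (hunif (f s)) 2)//.
congr expectationC; apply/funext => w.
rewrite /monomial (big_pred1 s) ?(negbTE ns) ?expr2// => t.
by rewrite (inj_eq finj).
Qed.

End MixedMoments.

Theorem theorem3p1 (R : realType) (n d : nat) (m : option nat)
    (hm : forall k : nat, m = Some k -> (3 <= k)%N)
    (g : 'cV[R[i]]_n -> R[i]) (G : tensor R[i] (n + n) d)
    (hg : general_conjugate_form d g) (hreal : real_valued g)
    (hG : conjugate_super_symmetric G) (hgG : associated g G)
    (disp : measure_display) (T : measurableType disp) (P : probability T R)
    (xi : 'I_d -> {RV P >-> borelC R})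
    (hindep : mutually_independent xi)
    (hunif : forall k : 'I_d, uniform_on_Omega m (xi k))
    (x y : 'I_d -> 'cV[R[i]]_n) :
  let Z (w : T) : R[i] :=
    (\prod_(k < d) (xi k w : R[i])^*) *
    g (\sum_(k < d) (conj_vec ((xi k w : R[i]) *: x k)
                     + (xi k w : R[i]) *: y k)) in
  integrableC P Z /\
  expectationC P Z =
    d`!%:R * multilinear_form G (fun k => col_mx (x k) (y k)).
Proof.
move=> Z.
pose z (c : 'I_d * bool) := if c.2 then col_mx (x c.1) (y c.1)
  else col_mx (conj_vec (y c.1)) (conj_vec (x c.1)).
pose M (phi : {ffun 'I_d -> 'I_d * bool}) := multilinear_form G (fun s => z (phi s)).
have prodE phi :
  integrableC P (fun w => \prod_k monomial d phi k (xi k w)) /\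
  expectationC P (fun w => \prod_k monomial d phi k (xi k w)) =
    \prod_k expectationC P (fun w => monomial d phi k (xi k w)).
  apply: (independent_expectationC_prod _ _ hindep
    (fun k (u : borelC R) => monomial d phi k (u : R[i]))).
    by move=> k; exact: measurable_monomial.
  by move=> k; exact: (integrableC_monomial _ _ hm _ hunif).
have ZE : Z = fun w => \sum_phi M phi * \prod_k monomial d phi k (xi k w).
  apply/funext => w; rewrite /Z hgG col_mx_conj_sum multilinear_form_sum mulr_sumr.
  apply: eq_bigr => phi _; rewrite mulrA [RHS]mulrC; congr (_ * _).
  rewrite big_split/=; congr (_ * _).
  rewrite (partition_big (fun s => (phi s).1) xpredT)//=.
  by apply: eq_bigr => k _; apply: eq_bigr => s /eqP ->.
have iM phi : integrableC P (fun w => M phi * \prod_k monomial d phi k (xi k w)).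
  by apply: integrableCZ; case: (prodE phi).
rewrite ZE; split; first exact: integrableC_sum.
rewrite expectationC_sum//.
rewrite (eq_bigr (fun phi => M phi *
    \prod_k expectationC P (fun w => monomial d phi k (xi k w)))); last first.
  by move=> phi _; have [iphi <-] := prodE phi; exact: expectationCZ.
rewrite (bigID (mem [set perm_true d s | s : 'S_d]%SET))/=.
rewrite [X in _ + X]big1 ?addr0; last first.
  move=> phi /(expectation_monomial_eq0 _ _ hm _ hunif)[k k0].
  by rewrite (bigD1 k)//= k0 mul0r mulr0.
rewrite big_imset/=; last by move=> s t _ _; exact: perm_true_inj.
rewrite (eq_bigr (fun=> multilinear_form G (fun k => col_mx (x k) (y k)))) => [|s _].
  by rewrite sumr_const card_Sn mulr_natl.
rewrite big1 ?mulr1 => [|k _]; last exact: expectation_monomial_perm hunif _ _.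
rewrite -(multilinear_form_perm _ _ _ _ _ s (proj1 hG)).
by apply: eq_bigr => i _; congr (_ * _); apply: eq_bigr => k _; rewrite ffunE.
Qed.
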